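(* Let $n$ be a positive integer and let $s \in (0,\pi)$. For every $R \in \mathcal{T}_n^c(s)$ we have $$\max_{t \in K}|R(t)| \leq T_{2n}(\sec(s/2)) = \frac12\left((\sec(s/2)+\tan(s/2))^{2n} + (\sec(s/2)-\tan(s/2))^{2n}\right).$$
   Context: $K := \mathbb{R} \pmod{2\pi}$, and $m$ denotes Lebesgue measure (for subsets of $K$, measured on one period, e.g. on $[-\pi,\pi)$). $\mathcal{T}_n^c$ is the set of all trigonometric polynomials $R(t)=\sum_{k=-n}^{n} c_k e^{ikt}$ of degree at most $n$ with complex coefficients $c_k$. For $s \in (0,2\pi)$, $\mathcal{T}_n^c(s) := \{R \in \mathcal{T}_n^c : m(\{t \in K : |R(t)| \leq 1\}) \geq 2\pi - s\}$. $T_{2n}$ is the Chebyshev polynomial of degree $2n$, defined by $T_{2n}(\cos t) = \cos(2nt)$. *)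

(* Defs.v *)
From mathcomp Require Import all_boot all_order all_algebra complex.
From mathcomp Require Import all_classical all_reals all_analysis.

Set Implicit Arguments.
Unset Strict Implicit.
Unset Printing Implicit Defensive.

Import Order.TTheory GRing.Theory Num.Theory.
Import ComplexField.Normc numFieldNormedType.Exports.

Local Open Scope classical_set_scope.
Local Open Scope complex_scope.
Local Open Scope ring_scope.

Section Defs.
Variable R : realType.
Implicit Types (m n : nat) (s t x : R) (f : R -> R[i]).

(* exp (i t), for real t *)
Definition expi t : R[i] := cos t +i* sin t.

(* Functions on K = R mod 2 pi are represented as functions on R; those below
   are 2 pi-periodic (trigpolyc_periodic). *)
Definition trigpolyc n : set (R -> R[i]) :=
  [set f | exists c : int -> R[i], forall t,
    f t = \sum_(k < n.*2.+1)
            c (k%:Z - n%:Z) * expi ((k%:Z - n%:Z)%:~R * t)].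

(* {t \in K : |f t| <= 1}, restricted to one period. *)
Definition small_set f : set R := [set t | - pi <= t < pi /\ normc (f t) <= 1].

Definition trigpolyc_small n s : set (R -> R[i]) :=
  [set f | trigpolyc n f /\
    ((2 * pi - s)%:E <= lebesgue_measure (small_set f))%E].

Definition is_maximum (A : set R) (M : R) := A M /\ ubound A M.

(* The unique polynomial T with T (cos t) = cos (m t) for all t; see
   chebyshev_polyE and chebyshev_poly_unique. *)
Definition chebyshev_poly m : {poly R} :=
  xget 0 [set p : {poly R} | forall t, p.[cos t] = cos (m%:R * t)].

Definition sec x : R := (cos x)^-1.

Lemma expi_periodic (k : int) t : expi (k%:~R * (t + 2 * pi)) = expi (k%:~R * t).
Proof.
have P x : expi (x + 2 * pi) = expi x.
  by rewrite /expi [2 * pi]mulr_natl cosD2pi sinD2pi.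
have N (j : nat) x : expi (x + j%:R * (2 * pi)) = expi x.
  elim: j x => [|j IH] x; first by rewrite mul0r addr0.
  by rewrite -natr1 mulrDl mul1r addrA P IH.
case: k => j; rewrite mulrDr; first exact: N.
by rewrite NegzE mulrNz -[in LHS](N j.+1) mulNr addrAC -addrA [in LHS]mulNr subrr addr0.
Qed.

Lemma trigpolyc_periodic n f : trigpolyc n f ->
  forall t, f (t + 2 * pi) = f t.
Proof. by move=> [c fE] t; rewrite !fE; apply: eq_bigr => k _; rewrite expi_periodic. Qed.

Lemma chebyshev_poly_unique (p q : {poly R}) :
  (forall t, p.[cos t] = q.[cos t]) -> p = q.
Proof.
move=> pq; apply/eqP; rewrite -subr_eq0; apply/negPn/negP => nz.
pose rs := [seq (i.+1%:R^-1 : R) | i <- iota 0 (size (p - q))].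
have urs : uniq rs.
  rewrite map_inj_uniq ?iota_uniq// => i j /invr_inj/eqP.
  by rewrite eqr_nat => /eqP[].
have : all (root (p - q)) rs.
  apply/allP => _ /mapP[i _ ->]; rewrite /root hornerD hornerN.
  rewrite -(@acosK _ i.+1%:R^-1) ?pq ?subrr// in_itv/=.
  rewrite invf_le1 ?ler1n ?ltr0n// andbT.
  by rewrite (@le_trans _ _ 0)// ?invr_ge0// oppr_le0.
by move=> /(max_poly_roots nz) /(_ urs); rewrite size_map size_iota ltnn.
Qed.

Lemma chebyshev_polyE m t : (chebyshev_poly m).[cos t] = cos (m%:R * t).
Proof.
move: t; rewrite /chebyshev_poly.
set A := (X in xget _ X); rewrite -[forall t, _]/(A _); apply: xgetPex.
suff [p [q [pA _]]] : exists p q : {poly R}, A p /\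
    forall t, q.[cos t] = cos (m.+1%:R * t) by exists p.
rewrite /A {A}; elim: m => [|m [p [q [pE qE]]]].
  by exists 1, 'X; split=> t /=; rewrite ?mul0r ?cos0 ?mul1r !hornerE.
exists q, ('X * q *+ 2 - p); split=> // t.
rewrite hornerD hornerN hornerMn hornerM hornerX pE qE.
have -> : m.+2%:R * t = m.+1%:R * t + t by rewrite -natr1 mulrDl mul1r.
have -> : m%:R * t = m.+1%:R * t - t by rewrite -natr1 mulrDl mul1r addrK.
rewrite cosB cosD mulr2n; set a := cos t; set b := cos _.
by rewrite (mulrC a b) opprD addrA addrK.
Qed.

End Defs.

(* Main.v *)
(* Let |f| attain its maximum at t0. The even part h of t |-> f (t0 + t) is a
   polynomial of degree n in cos t with h 0 = f t0, and |h| <= 1 on the set F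
   of those t in [0, pi] for which |f| <= 1 at both t0 + t and t0 - t; F has
   measure at least pi - s. Interpolate h at n + 1 nodes u_k in F and evaluate
   at 0, i.e. at cos t = 1. The extremal configuration is F = [s, pi] with the
   nodes t_k at which T_n (2 (1 + cos t) / (1 + cos s) - 1) = +-1; there the
   absolute values of the Lagrange weights add up to
   T_n (4 / (1 + cos s) - 1) = T_2n (sec (s / 2)). Since F has measure at least
   pi - s, its points u_k can be chosen with gaps no smaller than those of the
   t_k, and then each factor of each Lagrange weight is no larger than the
   corresponding factor for the t_k. *)

Require Import Defs.
From mathcomp Require Import all_boot all_order all_algebra complex.
From mathcomp Require Import all_classical all_reals all_analysis.
From mathcomp Require Import measurable_realfun zify lra ring.

Import Order.TTheory GRing.Theory Num.Theory.
Import ComplexField.Normc numFieldNormedType.Exports.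

Local Open Scope classical_set_scope.
Local Open Scope complex_scope.
Local Open Scope ring_scope.

Set Implicit Arguments.
Unset Strict Implicit.

(** * Lagrange interpolation over a field *)

Lemma lagrange_eval (F : fieldType) N (x : 'I_N -> F) (z : F) (p : {poly F}) :
  injective x -> (size p <= N)%N ->
  p.[z] = \sum_k p.[x k] * \prod_(j | j != k) ((z - x j) / (x k - x j)).
Proof.
move=> x_inj sp.
pose L k := \prod_(j | j != k) ((x k - x j)^-1 *: ('X - (x j)%:P)).
have LE k y : (L k).[y] = \prod_(j | j != k) ((y - x j) / (x k - x j)).
  by rewrite horner_prod; apply: eq_bigr => j _; rewrite hornerZ hornerXsubC mulrC.
have sL k : (size (L k) <= N)%N.
  rewrite /L (eq_bigr (fun j => ((x k - x j)^-1)%:P * ('X - (x j)%:P))); last first.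
    by move=> j _; rewrite mul_polyC.
  rewrite big_split /= -rmorph_prod mul_polyC (leq_trans (size_scale_leq _ _))//.
  rewrite (eq_bigl [in predC1 k])// -big_enum size_prod_XsubC.
  by rewrite -cardE cardC1 card_ord; case: N k {L LE sp x x_inj} => // -[].
(* [p] and its interpolant agree at [N] distinct points, while their difference has size at most
   [N]; so the difference vanishes. *)
pose q := p - \sum_k p.[x k] *: L k.
have q0 : q = 0.
  apply/eqP/negPn/negP => nz.
  have us : uniq [seq x k | k <- enum 'I_N] by rewrite map_inj_uniq ?enum_uniq.
  have /max_poly_roots/(_ us) : all (root q) [seq x k | k <- enum 'I_N].
    apply/allP => _ /mapP[k _ ->].
    rewrite /root hornerD hornerN horner_sum (bigD1 k)//= big1 ?addr0.
      rewrite hornerZ LE big1 ?mulr1 ?subrr// => j jk.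
      by rewrite divff// subr_eq0 (inj_eq x_inj) eq_sym.
    by move=> i ik; rewrite hornerZ LE (bigD1 k) 1?eq_sym//= subrr !mul0r mulr0.
  rewrite size_map size_enum_ord => /(_ nz); apply/negP; rewrite -leqNgt.
  rewrite (leq_trans (size_polyD _ _))// size_polyN geq_max sp /=.
  apply: (leq_trans (size_sum _ _ _)); apply/bigmax_leqP => k _.
  exact: leq_trans (size_scale_leq _ _) (sL k).
move/eqP: q0; rewrite subr_eq0 => /eqP ->.
rewrite horner_sum; apply: eq_bigr => k _; rewrite hornerZ LE; congr (_ * _).
rewrite horner_sum (bigD1 k)//= big1 ?addr0.
  by rewrite hornerZ LE big1 ?mulr1// => j jk; rewrite divff// subr_eq0 (inj_eq x_inj) eq_sym.
by move=> i ik; rewrite hornerZ LE (bigD1 k) 1?eq_sym//= subrr !mul0r mulr0.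
Qed.

(** * Chebyshev polynomials and a cosine inequality for angle gaps *)

Section Chebyshev.
Variable R : realType.
Implicit Types (m n : nat) (s t x : R).

Lemma chebyshev_poly0 : chebyshev_poly R 0 = 1.
Proof. by apply: chebyshev_poly_unique => t; rewrite chebyshev_polyE hornerC mul0r cos0. Qed.

Lemma chebyshev_poly1 : chebyshev_poly R 1 = 'X.
Proof. by apply: chebyshev_poly_unique => t; rewrite chebyshev_polyE hornerX mul1r. Qed.

Lemma chebyshev_polySS m : chebyshev_poly R m.+2 =
  'X * chebyshev_poly R m.+1 *+ 2 - chebyshev_poly R m.
Proof.
apply: chebyshev_poly_unique => t.
rewrite hornerD hornerN hornerMn hornerM hornerX !chebyshev_polyE.
have -> : m.+2%:R * t = m.+1%:R * t + t by rewrite -natr1 mulrDl mul1r.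
have -> : m%:R * t = m.+1%:R * t - t by rewrite -natr1 mulrDl mul1r addrK.
rewrite cosB cosD; ring.
Qed.

Lemma size_chebyshev_poly_le m : (size (chebyshev_poly R m) <= m.+1)%N.
Proof.
suff : (size (chebyshev_poly R m) <= m.+1)%N && (size (chebyshev_poly R m.+1) <= m.+2)%N.
  by case/andP.
elim: m => [|m /andP[IH0 IH1]].
  by rewrite chebyshev_poly0 chebyshev_poly1 size_poly1 size_polyX.
rewrite IH1 chebyshev_polySS (leq_trans (size_polyD _ _))// geq_max size_polyN.
apply/andP; split; last by do 2!apply: leqW.
rewrite mulr2n (leq_trans (size_polyD _ _))// maxnn; apply: (leq_trans (size_polyMleq _ _)).
by rewrite size_polyX.
Qed.

(** The numbers sec x + tan x and sec x - tan x have sum 2 sec x and product 1, so their powers obey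
    the recurrence of [chebyshev_polySS]. *)
Lemma chebyshev_poly_sec m (x : R) : cos x != 0 ->
  (chebyshev_poly R m).[sec x] =
  2^-1 * ((sec x + tan x) ^+ m + (sec x - tan x) ^+ m).
Proof.
move=> cx.
have st : sec x ^+ 2 = 1 + tan x ^+ 2 by rewrite -cos2_tan2// exprVn.
elim/ltn_ind: m => -[|[|m]] IH.
- by rewrite chebyshev_poly0 hornerC !expr0; field.
- by rewrite chebyshev_poly1 hornerX !expr1; field.
rewrite chebyshev_polySS hornerD hornerN hornerMn hornerM hornerX !IH//.
rewrite !(exprS _ m.+1) !(exprS _ m).
set a := (_ + _) ^+ m; set b := (_ - _) ^+ m.
(* Inserting the factor sec^2 - tan^2 = 1 turns the recurrence into a polynomial identity. *)
have -> : 2^-1 * (a + b) = 2^-1 * (a + b) * (sec x ^+ 2 - tan x ^+ 2).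
  by rewrite st addrK mulr1.
ring.
Qed.

(** On the values cos t this is cos (2 n t) = cos (n (2 t)); [chebyshev_poly_unique] extends it to
    every [x], in particular to secants, which lie outside ]-1, 1[. *)
Lemma chebyshev_poly_double n (x : R) :
  (chebyshev_poly R (2 * n)).[x] = (chebyshev_poly R n).[2 * x ^+ 2 - 1].
Proof.
have -> : chebyshev_poly R (2 * n) = chebyshev_poly R n \Po (2%:P * 'X ^+ 2 - 1).
  apply: chebyshev_poly_unique => t; rewrite horner_comp chebyshev_polyE.
  have -> : (2%:P * 'X ^+ 2 - 1).[cos t] = cos (t *+ 2).
    by rewrite cos_mulr2n hornerD hornerN hornerM hornerXn !hornerC; ring.
  by rewrite chebyshev_polyE; congr cos; rewrite natrM -(mulr_natl t); ring.
by rewrite horner_comp hornerD hornerN hornerM hornerXn !hornerC.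
Qed.

(** The argument on the right is the image of 1 under the affine map taking [-1, cos s] onto
    [-1, 1]; the weights of the extremal nodes are summed in that form. *)
Lemma chebyshev_poly_half n (s : R) : cos (s / 2) != 0 ->
  (chebyshev_poly R (2 * n)).[sec (s / 2)] =
  (chebyshev_poly R n).[4 / (1 + cos s) - 1].
Proof.
move=> cs; rewrite chebyshev_poly_double; congr (_.[_]).
have -> : cos s = 2 * cos (s / 2) ^+ 2 - 1.
  by rewrite [2 * _]mulr_natl -cos_mulr2n; congr cos; field.
rewrite /sec; field; rewrite cs /=.
suff -> : 1 + (2 * cos (s / 2) ^+ 2 - 1) = 2 * cos (s / 2) ^+ 2.
  by rewrite mulf_neq0// expf_neq0.
by ring.
Qed.

Lemma ler_sin_pihalf (x y : R) : 0 <= x -> x <= y -> y <= pi / 2 -> sin x <= sin y.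
Proof.
move=> x0 xy yp; rewrite le_eqVlt in xy; case/predU1P: xy => [->//|xy].
have p := pi_gt0 R.
rewrite ltW// ltr_sin// in_itv/=; apply/andP; split; lra.
Qed.

(* Half-angle form: 1 - cos y = 2 sin^2 (y/2), and
   sin b' sin (a' - d) - sin (b' - d) sin a' = sin d sin (a' - b'). *)
Lemma one_sub_cos_ratio (x y x' y' : R) :
  0 <= y -> y <= y' -> y' <= x' -> x' <= pi -> x <= pi -> x' - y' <= x - y ->
  (1 - cos y) * (1 - cos x') <= (1 - cos y') * (1 - cos x).
Proof.
move=> y0 yy' yx' x'p xp xy.
have p := pi_gt0 R.
have E (z : R) : 1 - cos z = 2 * sin (z / 2) ^+ 2.
  have -> : cos z = cos ((z / 2) *+ 2) by congr cos; field.
  by rewrite cos_mulr2n cos2sin2; ring.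
have S (z : R) : 0 <= z -> z <= pi -> 0 <= sin (z / 2).
  by move=> *; apply: sin_ge0_pi; apply/andP; split; lra.
rewrite !E.
suff H : sin (y / 2) * sin (x' / 2) <= sin (y' / 2) * sin (x / 2).
  have -> (u v : R) : 2 * u ^+ 2 * (2 * v ^+ 2) = 4 * (u * v) ^+ 2 by ring.
  have -> (u v : R) : 2 * u ^+ 2 * (2 * v ^+ 2) = 4 * (u * v) ^+ 2 by ring.
  rewrite ler_pM2l// lerXn2r// nnegrE mulr_ge0// S//; lra.
(* The gap hypothesis says x / 2 >= x' / 2 - d, so the sine of x / 2 can be lowered to that of x' /
   2 - d; then both half-angles on the left exceed or equal their shifts by the same [d]. *)
pose d := (y' - y) / 2.
apply: (@le_trans _ _ (sin (y' / 2) * sin (x' / 2 - d))); last first.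
  apply: ler_wpM2l; first by apply: S; lra.
  by apply: ler_sin_pihalf; rewrite /d; lra.
have -> : y / 2 = y' / 2 - d by rewrite /d; field.
rewrite -subr_ge0 !sinB.
have -> : sin (y' / 2) * (sin (x' / 2) * cos d - cos (x' / 2) * sin d) -
  (sin (y' / 2) * cos d - cos (y' / 2) * sin d) * sin (x' / 2) =
  sin d * sin (x' / 2 - y' / 2) by rewrite sinB; ring.
by apply: mulr_ge0; apply: sin_ge0_pi; rewrite /d; apply/andP; split; lra.
Qed.

End Chebyshev.

Lemma sum_ltn_ord N k : (\sum_(j < N) (k < j)%N = N.-1 - k)%N.
Proof.
elim: N => [|N IH]; first by rewrite big_ord0.
by rewrite big_ord_recr /= IH; case: (ltnP k N); lia.
Qed.

(** Numerators are nonnegative, and the denominator is negative exactly for the N - k indices j > k.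
    The exponent N + k has the same parity and is the one produced by the extremal nodes. *)
Lemma norm_lagrange_weight (F : realFieldType) N (x : 'I_N.+1 -> F) (z : F) k :
  {homo x : i j / (i < j)%N >-> i < j} -> (forall j, x j <= z) ->
  `|\prod_(j | j != k) ((z - x j) / (x k - x j))| =
  (-1) ^+ (N + k) * \prod_(j | j != k) ((z - x j) / (x k - x j)).
Proof.
move=> x_lt xz; rewrite normr_prod.
have E j : j != k -> `|(z - x j) / (x k - x j)| =
    (-1) ^+ (k < j)%N * ((z - x j) / (x k - x j)).
  rewrite neq_ltn normf_div (ger0_norm (x := z - x j)) ?subr_ge0//.
  case: (ltngtP j k) => // jk _ /=.
    by rewrite expr0 mul1r gtr0_norm// subr_gt0 x_lt.
  by rewrite expr1 mulN1r ltr0_norm ?subr_lt0 ?x_lt// invrN mulrN.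
rewrite (eq_bigr _ E) big_split /=; congr (_ * _).
rewrite prodrXr; have -> : (\sum_(j < N.+1 | j != k) (k < j) = N - k)%N.
  by rewrite -[RHS](sum_ltn_ord N.+1) [in RHS](bigD1 k)//= ltnn.
by rewrite -[LHS]signr_odd -[RHS]signr_odd oddD oddB// -ltnS.
Qed.

(** * Comparison of Lagrange factors for two sequences of angles *)

Section Nodes.
Variables (R : realType) (n : nat) (t u : nat -> R).
Hypotheses (t_lt : forall k, (k < n)%N -> t k.+1 < t k)
  (t_le : t 0%N <= pi) (t_ge : 0 <= t n)
  (u_ge : forall k, (k <= n)%N -> 0 <= u k) (u_le : u 0%N <= t 0%N)
  (gap : forall k, (k < n)%N -> t k - t k.+1 <= u k - u k.+1).

Lemma gap_le i j : (i <= j <= n)%N -> t i - t j <= u i - u j.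
Proof.
elim: j => [|j IH]; first by rewrite leqn0 => /andP[/eqP -> _]; rewrite !subrr.
case/andP; rewrite leq_eqVlt => /predU1P[-> _|ij jn]; first by rewrite !subrr.
have := gap jn; have := IH; rewrite -ltnS ij ltnW// => /(_ isT); lra.
Qed.

Lemma nodes_lt i j : (i < j <= n)%N -> t j < t i.
Proof.
elim: j => // j IH /andP[]; rewrite ltnS leq_eqVlt => /predU1P[-> /t_lt//|ij jn].
by apply: lt_trans (t_lt jn) (IH _); rewrite ij ltnW.
Qed.

Lemma node_itv i : (i <= n)%N -> 0 <= t i <= pi.
Proof.
move=> i_n; apply/andP; split.
  move: i_n; rewrite leq_eqVlt => /predU1P[->//|i_n].
  by apply: le_trans t_ge (ltW (nodes_lt _)); rewrite i_n leqnn.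
case: i i_n => // i i_n; apply: le_trans t_le; apply/ltW/nodes_lt.
by rewrite i_n.
Qed.

(** [u] starts no higher than [t] and descends at least as fast. *)
Lemma node_le i : (i <= n)%N -> u i <= t i.
Proof. by move=> i_n; have := @gap_le 0%N i; rewrite i_n => /(_ isT); have := u_le; lra. Qed.

Lemma cos_node_lt i j : (i < j <= n)%N -> cos (u i) < cos (u j).
Proof.
move=> ij; have /andP[i_j j_n] := ij; have i_n := ltnW (leq_trans i_j j_n).
have /andP[_ tip] := node_itv i_n; have /andP[_ tjp] := node_itv j_n.
have G : t i - t j <= u i - u j by apply: gap_le; rewrite j_n ltnW.
have L := nodes_lt ij; have ui0 := u_ge i_n; have uj0 := u_ge j_n.
have ui := node_le i_n; have uj := node_le j_n.
by rewrite ltr_cos ?in_itv/=; [lra|apply/andP; split; lra..].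
Qed.

(** Write U_i = 1 - cos (u i) and T_i = 1 - cos (t i). The factors are U_j / (U_j - U_k) and T_j /
    (T_j - T_k) in absolute value; after cross-multiplication the terms U_j T_j cancel and
    [one_sub_cos_ratio] remains, for either order of [j] and [k]. *)
Lemma lagrange_factor_le j k : (j <= n)%N -> (k <= n)%N -> j != k ->
  `|(1 - cos (u j)) / (cos (u k) - cos (u j))| <=
  `|(1 - cos (t j)) / (cos (t k) - cos (t j))|.
Proof.
have D i l : (i < l <= n)%N ->
  [/\ (1 - cos (u l)) * (1 - cos (t i)) <= (1 - cos (t l)) * (1 - cos (u i)),
   0 < cos (u l) - cos (u i) & 0 < cos (t l) - cos (t i)].
  move=> il; have /andP[i_l l_n] := il; have i_n := ltnW (leq_trans i_l l_n).
  have /andP[ti0 tip] := node_itv i_n; have /andP[tl0 tlp] := node_itv l_n.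
  have G : t i - t l <= u i - u l by apply: gap_le; rewrite l_n ltnW.
  have L := nodes_lt il; have ui0 := u_ge i_n; have ul0 := u_ge l_n.
  have ui := node_le i_n; have ul := node_le l_n.
  split; first by apply: one_sub_cos_ratio; lra.
    by rewrite subr_gt0 cos_node_lt.
  by rewrite subr_gt0 ltr_cos ?in_itv/=; [lra|apply/andP; split; lra..].
move=> jn kn; rewrite !normf_div neq_ltn => /orP[jk|kj].
  have [|r du dt] := D j k; first by rewrite jk.
  rewrite (gtr0_norm du) (gtr0_norm dt) !ger0_norm ?subr_ge0 ?cos_le1//.
  rewrite ler_pdivrMr// mulrAC ler_pdivlMr//; lra.
have [|r du dt] := D k j; first by rewrite kj.
rewrite (distrC (cos (u k))) (distrC (cos (t k))) (gtr0_norm du) (gtr0_norm dt) !ger0_norm ?subr_ge0 ?cos_le1//.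
rewrite ler_pdivrMr// mulrAC ler_pdivlMr//; lra.
Qed.

End Nodes.

(** * The extremal nodes, their weights, and the bound for cosine sums *)

Section ChebyshevNodes.
Variables (R : realType) (n : nat) (s : R).
Hypotheses (n_gt0 : (0 < n)%N) (s_gt0 : 0 < s) (s_lt : s < pi).

(* Preimages under [x |-> 2 (1 + x) / (1 + cos s) - 1] of the extrema of T_n,
   listed in increasing order from [-1] to [cos s]. *)
Definition remez_node (k : nat) : R :=
  (1 + cos s) * (1 - cos (k%:R * pi / n%:R)) / 2 - 1.

Lemma cos_gtN1 : 0 < 1 + cos s.
Proof.
have s0 := s_gt0; have sp := s_lt.
have : cos pi < cos s by rewrite ltr_cos ?in_itv/=; [lra|apply/andP; split; lra..].
by rewrite cospi; lra.
Qed.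

Lemma remez_node0 : remez_node 0 = -1.
Proof. by rewrite /remez_node mul0r mul0r cos0 subrr mulr0 mul0r add0r. Qed.

Lemma remez_noden : remez_node n = cos s.
Proof.
rewrite /remez_node; have -> : n%:R * pi / n%:R = pi :> R.
  by rewrite mulrAC divff ?mul1r// pnatr_eq0 -lt0n.
by rewrite cospi; field.
Qed.

Lemma remez_node_lt i j : (i < j <= n)%N -> remez_node i < remez_node j.
Proof.
move=> /andP[ij jn]; rewrite /remez_node ltrD2r ltr_pM2r// ltr_pM2l ?cos_gtN1//.
have n0 : 0 < n%:R :> R by rewrite ltr0n.
have p := pi_gt0 R.
have I k : (k <= n)%N -> (k%:R * pi / n%:R : R) \in `[0, pi]%R.
  move=> kn; rewrite in_itv/=; apply/andP; split.
    by apply: divr_ge0; [apply: mulr_ge0; [exact: ler0n|exact: ltW]|exact: ler0n].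
  by rewrite -[leRHS](mulfK (lt0r_neq0 n0)) (mulrC pi) ler_pM2r ?invr_gt0// ler_pM2r// ler_nat.
rewrite ltrD2l ltrN2 ltr_cos ?I ?(leq_trans (ltnW ij))//.
by rewrite ltr_pM2r ?invr_gt0// ltr_pM2r// ltr_nat.
Qed.

Lemma remez_node_itv k : (k <= n)%N -> -1 <= remez_node k <= 1.
Proof.
move=> kn; have c := cos_gtN1; apply/andP; split.
  rewrite -remez_node0; case: k kn => // k kn.
  by rewrite ltW// remez_node_lt.
apply: le_trans (cos_le1 s); rewrite -remez_noden.
move: kn; rewrite leq_eqVlt => /predU1P[->//|kn].
by rewrite ltW// remez_node_lt// kn leqnn.
Qed.

(** T_n composed with the affine map [l] of [-1, cos s] onto [-1, 1] takes the value (-1)^(n+k) at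
    node [k], which is the sign of the k-th weight. Its Lagrange expansion at 1 is therefore the sum
    of the absolute values. *)
Lemma sum_norm_lagrange_remez_node :
  \sum_(k < n.+1) `|\prod_(j < n.+1 | j != k)
     ((1 - remez_node j) / (remez_node k - remez_node j))| =
  (chebyshev_poly R n).[4 / (1 + cos s) - 1].
Proof.
have c := cos_gtN1.
pose l := (2 / (1 + cos s))%:P * (1 + 'X) - 1 : {poly R}.
have lE z : l.[z] = 2 / (1 + cos s) * (1 + z) - 1.
  by rewrite /l hornerD hornerN hornerM hornerD hornerX !hornerC.
have -> : 4 / (1 + cos s) - 1 = l.[1] by rewrite lE; field; lra.
rewrite -horner_comp.
have xlt : {homo (fun i : 'I_n.+1 => remez_node i) : i j / (i < j)%N >-> i < j}.
  by move=> i j ij; rewrite remez_node_lt// ij -ltnS ltn_ord.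
rewrite [RHS](@lagrange_eval _ n.+1 (fun i => remez_node i)).
- apply: eq_bigr => k _.
  rewrite (@norm_lagrange_weight _ n (fun i => remez_node i))//; last first.
    by move=> j; have /andP[] := @remez_node_itv j (ltn_ord j).
  congr (_ * _); rewrite horner_comp lE.
  (* The increasing order of the nodes gives - cos (k pi / n); the shift by pi absorbs this sign,
     and n times the new angle is (n + k) pi. *)
  have -> : 2 / (1 + cos s) * (1 + remez_node k) - 1 = cos (k%:R * pi / n%:R + pi).
    by rewrite cosDpi /remez_node; field; lra.
  rewrite chebyshev_polyE.
  have -> : n%:R * (k%:R * pi / n%:R + pi) = 0 + pi *+ (n + k) :> R.
    by rewrite -(mulr_natl pi) natrD; field; rewrite pnatr_eq0 -lt0n.
  by rewrite alternatingn ?cos0 ?mulr1//; exact: cosDpi.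
- move=> i j ij; apply/val_inj; case: (ltngtP i j) => // /xlt; rewrite ij ltxx//.
- rewrite (leq_trans (size_comp_poly_leq _ _))// ltnS.
  have sl : ((size l).-1 <= 1)%N.
    suff : (size l <= 2)%N by case: (size l) => //.
    rewrite (leq_trans (size_polyD _ _))// size_polyN size_poly1 geq_max andbT.
    rewrite mul_polyC (leq_trans (size_scale_leq _ _))//.
    by rewrite (leq_trans (size_polyD _ _))// size_poly1 size_polyX.
  apply: leq_trans (leq_mul (leqnn _) sl) _; rewrite muln1.
  by have := size_chebyshev_poly_le R n; case: (size _).
Qed.

(** Decreasing from pi at 0 to [s] at [n]: this is the sequence [t] to be compared with arbitrary
    [u]. *)
Definition remez_angle k : R := acos (remez_node k).

Lemma remez_angle_lt k : (k < n)%N -> remez_angle k.+1 < remez_angle k.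
Proof.
move=> kn; have I1 := remez_node_itv kn; have I0 := remez_node_itv (ltnW kn).
rewrite -ltr_cos ?in_itv/= ?acos_ge0 ?acos_lepi// !acosK ?in_itv//.
by rewrite remez_node_lt// kn leqnn.
Qed.

Lemma remez_angle0 : remez_angle 0 = pi.
Proof. by rewrite /remez_angle remez_node0 acosN1. Qed.

Lemma remez_anglen : remez_angle n = s.
Proof.
have s0 := s_gt0; have sp := s_lt.
by rewrite /remez_angle remez_noden cosK// in_itv/=; apply/andP; split; lra. Qed.

(** The cosine sum is a polynomial of degree at most [n] in the cosine, and its value at angle 0 is
    the sum of the [a i]. Repeated frequencies in [d] are allowed. *)
Lemma cos_sum_remez (u : nat -> R) m (a : 'I_m -> R[i]) (d : 'I_m -> nat) :
  (forall i, (d i <= n)%N) ->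
  (forall k, (k <= n)%N -> 0 <= u k) -> u 0%N <= pi ->
  (forall k, (k < n)%N -> remez_angle k - remez_angle k.+1 <= u k - u k.+1) ->
  (forall k, (k <= n)%N ->
     normc (\sum_i a i * (cos ((d i)%:R * u k))%:C) <= 1) ->
  normc (\sum_i a i) <= (chebyshev_poly R (2 * n)).[sec (s / 2)].
Proof.
move=> dn u0 up gap h1.
have [p0 a0 an] : [/\ 0 < pi :> R, remez_angle 0 <= pi & 0 <= remez_angle n].
  by rewrite remez_angle0 remez_anglen lexx ltW// pi_gt0.
have ua : u 0%N <= remez_angle 0 by rewrite remez_angle0.
pose x (k : 'I_n.+1) := cos (u k).
pose w k := \prod_(j < n.+1 | j != k) ((1 - x j) / (x k - x j)).
have xinj : injective x.
  suff H (i j : 'I_n.+1) : (i < j)%N -> x i != x j.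
    by move=> i j ij; apply/val_inj; case: (ltngtP i j) => // /H; rewrite ij eqxx.
  move=> ij; rewrite lt_eqF//.
  by apply: (cos_node_lt remez_angle_lt a0 an u0 ua gap); rewrite ij -ltnS ltn_ord.
(* Each T_(d i), whose value at 1 is 1, is interpolated separately: the weights stay real and the
   complex coefficients enter only linearly. *)
have w1 (i : 'I_m) : \sum_(k < n.+1) cos ((d i)%:R * u k) * w k = 1.
  have /(@lagrange_eval _ n.+1 x 1) /= : injective x := xinj.
  move=> /(_ (chebyshev_poly R (d i))) E.
  transitivity ((chebyshev_poly R (d i)).[1]).
    rewrite E; last by apply: leq_trans (size_chebyshev_poly_le _ _) _; rewrite ltnS.
    by apply: eq_bigr => k _; rewrite chebyshev_polyE.
  by rewrite -(cos0 R) chebyshev_polyE mulr0.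
have -> : \sum_i a i = \sum_(k < n.+1) (\sum_i a i * (cos ((d i)%:R * u k))%:C) * (w k)%:C.
  under [RHS]eq_bigr do rewrite mulr_suml.
  rewrite exchange_big; apply: eq_bigr => i _ /=.
  under eq_bigr do rewrite -mulrA -rmorphM /=.
  by rewrite -mulr_sumr -rmorph_sum /= w1 mulr1.
have s0 := s_gt0; have sp := s_lt.
have c0 : cos (s / 2) != 0.
  by rewrite gt_eqF// cos_gt0_pihalf//; apply/andP; split; lra.
rewrite chebyshev_poly_half// -sum_norm_lagrange_remez_node.
have normc_sum (F : 'I_n.+1 -> R[i]) : normc (\sum_k F k) <= \sum_k normc (F k).
  elim/big_ind2 : _ => [|y y' z z' yy' zz'|//]; first by rewrite normc0.
  exact: le_trans (le_normcD _ _) (lerD yy' zz').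
apply: le_trans (normc_sum _) _; apply: ler_sum => k _.
rewrite normcM -[leRHS]mul1r; apply: ler_pM.
- by rewrite /normc; case: (\sum_i _) => ? ?; rewrite sqrtr_ge0.
- by rewrite /= sqrtr_ge0.
- by apply: h1; rewrite -ltnS.
(* The data have modulus at most 1, so only the weights are left to compare, factor by factor. *)
rewrite /= expr0n addr0 sqrtr_sqr !normr_prod; apply: ler_prod => j jk.
rewrite normr_ge0 /=.
have C i : (i <= n)%N -> remez_node i = cos (remez_angle i).
  by move=> i_n; rewrite /remez_angle acosK// in_itv/=; exact: remez_node_itv.
have [jn kn] : (j <= n)%N /\ (k <= n)%N by rewrite -!(ltnS _ n) !ltn_ord.
rewrite !C//.
exact: (lagrange_factor_le remez_angle_lt a0 an u0 ua gap jn kn jk).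
Qed.

End ChebyshevNodes.

(** * Lebesgue measure on the line: symmetries, separated points, periodic sets *)

Section Measure.
Variable R : realType.
Implicit Types (a b c s t x : R) (A B : set R).
Notation mu := (@lebesgue_measure R).

(** The pushforward of the measure under [f] gives half-open intervals their length, and Lebesgue
    measure is the only measure that does. *)
Lemma lebesgue_measure_preimage (f : R -> R) A :
  measurable_fun [set: R] f ->
  (forall a b, a < b -> mu (f @^-1` `]a, b]) = (b - a)%:E) ->
  measurable A -> mu (f @^-1` A) = mu A.
Proof.
move=> mf fE mA.
pose T := measurableTypeR R.
pose nu : {measure set T -> \bar R} :=
  pushforward (mu : {measure set T -> \bar R}) (f : T -> T).
suff H X : ocitv X -> mu X = nu mf X by exact/esym/(lebesgue_measure_unique H mA).
move: X.
move=> X /ocitvP[->|[[a b] /= ab ->]]; first by rewrite !measure0.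
by rewrite [RHS]fE// lebesgue_measure_itv/= lte_fin ab.
Qed.

Lemma lebesgue_measure_translate c A : measurable A ->
  mu ((fun x => c + x) @^-1` A) = mu A.
Proof.
apply: lebesgue_measure_preimage; first exact: measurable_funD.
move=> a b ab; have -> : (fun x => c + x) @^-1` `]a, b] = `]a - c, b - c]%classic.
  by apply/seteqP; split => x /=; rewrite !in_itv/= => /andP[? ?]; apply/andP; split; lra.
rewrite lebesgue_measure_itv/= lte_fin ltrD2r ab -EFinB; congr (_%:E); ring.
Qed.

Lemma lebesgue_measure_reflect c A : measurable A ->
  mu ((fun x => c - x) @^-1` A) = mu A.
Proof.
apply: lebesgue_measure_preimage; first exact: measurable_funB.
move=> a b ab; have -> : (fun x => c - x) @^-1` `]a, b] = `[c - b, c - a[%classic.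
  by apply/seteqP; split => x /=; rewrite !in_itv/= => /andP[? ?]; apply/andP; split; lra.
rewrite lebesgue_measure_itv/= lte_fin ltrD2l ltrN2 ab -EFinB; congr (_%:E); ring.
Qed.

Lemma compact_max A : compact A -> A !=set0 -> exists2 m, A m & forall x, A x -> x <= m.
Proof.
move=> cA A0.
have [|m mA mM] := @compact_EVT_max _ R id A A0 cA.
  by apply: continuous_subspaceT => x; exact: cvg_id.
by exists m => [|x xA]; [rewrite inE in mA|apply: mM; rewrite inE].
Qed.

Lemma compact_min A : compact A -> A !=set0 -> exists2 m, A m & forall x, A x -> m <= x.
Proof.
move=> cA A0.
have [|m mA mM] := @compact_EVT_min _ R id A A0 cA.
  by apply: continuous_subspaceT => x; exact: cvg_id.
by exists m => [|x xA]; [rewrite inE in mA|apply: mM; rewrite inE].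
Qed.

Lemma compact_measurable A : compact A -> measurable A.
Proof. by move=> /(compact_closed (@norm_hausdorff _ _)); exact: closed_measurable. Qed.

(* Greedy choice from the right: take the largest point of [A], discard the
   part of [A] closer to it than the required gap, and iterate. *)
Lemma compact_gap_points n (t : nat -> R) A b :
  (forall k, (k < n)%N -> t k.+1 < t k) -> compact A -> A !=set0 ->
  (forall x, A x -> x <= b) -> ((t 0%N - t n)%:E <= mu A)%E ->
  exists u : nat -> R, [/\ forall k, (k <= n)%N -> A (u k), u 0%N <= b &
    forall k, (k < n)%N -> t k - t k.+1 <= u k - u k.+1].
Proof.
elim: n t A b => [|n IH] t A b t_lt cA A0 Ab muA.
  (* For n = 0 the measure bound is vacuous, so the point comes from [A0]. *)
  by have [x Ax] := A0; exists (fun=> x); split => //; exact: Ab.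
have mA := compact_measurable cA.
have [c Ac cM] := compact_max cA A0.
pose g := t 0%N - t 1%N.
have g0 : 0 < g by rewrite subr_gt0 t_lt.
have tn1 : t n.+1 <= t 1%N.
  case: n {IH muA} t_lt => // n t_lt; apply/ltW.
  by apply: (nodes_lt t_lt); rewrite leqnn.
pose A' := A `&` [set` `]-oo, c - g]].
have cA' : compact A' by apply: compact_closedI => //; exact: interval_closed.
have A'0 : A' !=set0.
  (* Otherwise [A] lies in [m, c] with c - m < g. Using the attained minimum [m] makes this strict,
     which is needed when the measure bound is exactly [g]. *)
  apply: contrapT => nA'.
  have [m Am mM] := compact_min cA A0.
  have mc : c - g < m.
    by rewrite ltNge; apply/negP => mg; apply: nA'; exists m; split=> //=; rewrite ?in_itv.
  have : (mu A <= mu `[m, c])%E.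
    apply: le_measure; rewrite ?inE//.
    by move=> x Ax /=; rewrite in_itv/= mM// cM.
  rewrite lebesgue_measure_itv/= lte_fin.
  have := cM _ Am; rewrite le_eqVlt => /predU1P[<-|mc'].
    rewrite ltxx => /(le_trans muA); rewrite lee_fin; rewrite /g in g0 *; lra.
  rewrite mc' -EFinB => /(le_trans muA); rewrite lee_fin; rewrite /g in g0 mc *; lra.
(* The discarded part lies in an interval of length [g], the first gap. *)
have muA' : ((t 1%N - t n.+1)%:E <= mu A')%E.
  have : (mu A <= mu (A' `|` `](c - g)%R, c]))%E.
    apply: le_measure; rewrite ?inE//.
      by apply: measurableU => //; exact: compact_measurable.
    move=> x Ax; have [xg|xg] := leP x (c - g); [left|right] => /=.
      by split => //=; rewrite in_itv.
    by rewrite in_itv/= xg cM.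
  move=> /(le_trans muA)/le_trans/(_ (measureU2 _ _ _)).
  move=> /(_ (compact_measurable cA') (measurable_itv _)).
  rewrite [X in (_ + X)%E]lebesgue_measure_itv/= lte_fin ltrBlDr ltrDl g0 -EFinB.
  rewrite -leeBlDr// -EFinB; apply: le_trans; rewrite lee_fin /g; lra.
(* The upper bound [c - g] passed to the induction hypothesis becomes the gap between [c] and the
   next point. *)
have [||u [uA' u0 ug]] := IH (fun k => t k.+1) A' (c - g) _ cA' A'0 _ muA'.
- by move=> k kn; exact: t_lt.
- by move=> x [_ /=]; rewrite in_itv.
exists (fun k => if k is j.+1 then u j else c); split => //.
- by case=> // k kn; have [] := uA' k kn.
- exact: Ab.
- case=> [_|k kn]; last exact: ug.
  by move: u0; rewrite /g; lra.
Qed.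

Lemma lebesgue_measureU2 A B : measurable A -> measurable B ->
  (mu (A `|` B) <= mu A + mu B)%E.
Proof.
exact: (@measureU2 _ (measurableTypeR R) _ (mu : {measure set (measurableTypeR R) -> \bar R})).
Qed.

Lemma lebesgue_measureU A B : measurable A -> measurable B ->
  A `&` B = set0 -> mu (A `|` B) = (mu A + mu B)%E.
Proof.
move=> mA mB AB.
exact: (@measureU _ _ (measurableTypeR R) (mu : {measure set (measurableTypeR R) -> \bar R}) A B mA mB AB).
Qed.

(** Both windows contain [a, pi[; the remaining piece [pi, a + 2 pi[ is [-pi, a[ moved by one
    period. *)
Lemma periodic_measure A a : measurable A ->
  (forall x, A (x + 2 * pi) <-> A x) -> - pi <= a <= pi ->
  mu (A `&` `[a, a + 2 * pi[) = mu (A `&` `[- pi, pi[).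
Proof.
move=> mA pA /andP[a1 a2]; have p := pi_gt0 R.
have -> : A `&` `[a, a + 2 * pi[ = (A `&` `[a, pi[) `|` (A `&` `[pi, a + 2 * pi[).
  rewrite -setIUr; congr (_ `&` _); apply/seteqP; split => x /=; rewrite !in_itv/=.
    by move=> /andP[xa xp]; have [xpi|xpi] := ltP x pi; [left|right]; apply/andP; split; lra.
  by move=> [] /andP[? ?]; apply/andP; split; lra.
have -> : A `&` `[- pi, pi[ = (A `&` `[a, pi[) `|` (A `&` `[- pi, a[).
  rewrite -setIUr; congr (_ `&` _); apply/seteqP; split => x /=; rewrite !in_itv/=.
    by move=> /andP[xa xp]; have [xpi|xpi] := ltP x a; [right|left]; apply/andP; split; lra.
  by move=> [] /andP[? ?]; apply/andP; split; lra.
have mI (i : interval R) : measurable (A `&` [set` i]) by exact: measurableI.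
rewrite !lebesgue_measureU//; last 2 first.
- apply/seteqP; split => // x /= [[_ +] [_ +]]; rewrite !in_itv/= => /andP[? ?] /andP[? ?]; lra.
- apply/seteqP; split => // x /= [[_ +] [_ +]]; rewrite !in_itv/= => /andP[? ?] /andP[? ?]; lra.
congr (_ + _)%E; rewrite -(@lebesgue_measure_translate (2 * pi) (A `&` `[pi, a + 2 * pi[))//.
congr (mu _); apply/seteqP; split => x /=; rewrite addrC pA !in_itv/= => -[Ax /andP[? ?]];
  (split=> //; apply/andP; split; lra).
Qed.

(** A point x of ]0, pi[ is lost only if t + x or t - x lies outside [B]. The two sets of lost
    points are a translate and a reflection of disjoint parts of the complement, to the right and
    left of [t] in one period, so together they cost at most [s]. *)
Lemma symmetric_measure_ge B t s : closed B ->
  (forall x, B (x + 2 * pi) <-> B x) -> 0 <= t <= 2 * pi ->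
  ((2 * pi - s)%:E <= mu (B `&` `[(- pi)%R, pi[))%E ->
  ((pi - s)%:E <= mu (`[0%R, pi] `&` ([set x | B (t + x)%R] `&` [set x | B (t - x)%R])))%E.
Proof.
move=> cB pB /andP[t0 t2] muB; have p := pi_gt0 R.
have mB : measurable B by exact: closed_measurable.
have mC := measurableC mB.
have pC x : (~` B) (x + 2 * pi) <-> (~` B) x by rewrite /setC /= pB.
(* The window is recentred at [t], so that its two halves match the two signs. *)
have muC : (mu (~` B `&` `[(t - pi)%R, (t + pi)%R[) <= s%:E)%E.
  have := @periodic_measure _ (t - pi) mC pC.
  have -> : t - pi + 2 * pi = t + pi by ring.
  move=> -> ; last by apply/andP; split; lra.
  have : mu `[- pi, pi[ = (mu (B `&` `[(- pi)%R, pi[) + mu (~` B `&` `[(- pi)%R, pi[))%E.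
    rewrite -lebesgue_measureU; last 3 first.
    - exact: measurableI.
    - exact: measurableI.
    - by rewrite setIACA setICr set0I.
    by rewrite -setIUl setUv setTI.
  rewrite lebesgue_measure_itv/= lte_fin gtrN// -EFinB.
  have -> : pi - - pi = 2 * pi :> R by ring.
  set mC' := mu (~` B `&` _) => E.
  have : ((2 * pi - s)%:E + mC' <= (2 * pi)%:E)%E by rewrite E; exact: leeD2r.
  case: mC' {E} => [r| |]; rewrite ?leNye//.
  by rewrite -EFinD !lee_fin; lra.
have mt : measurable [set x | B (t + x)%R].
  by rewrite -[X in measurable X]setTI; apply: (@measurable_funD _ _ _ setT (cst t) id).
have mr : measurable [set x | B (t - x)%R].
  by rewrite -[X in measurable X]setTI; apply: (@measurable_funB _ _ _ setT (cst t) id).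
pose F := `[0%R, pi] `&` ([set x | B (t + x)%R] `&` [set x | B (t - x)%R]).
have mF : measurable F by apply: measurableI => //; exact: measurableI.
rewrite -[X in mu X]/F.
pose D1 := (fun x => t + x) @^-1` (~` B `&` `]t, (t + pi)%R[).
pose D2 := (fun x => t - x) @^-1` (~` B `&` `](t - pi)%R, t[).
have mI (i : interval R) : measurable (~` B `&` [set` i]) by exact: measurableI.
have mD1 : measurable D1.
  by rewrite -[X in measurable X]setTI; apply: (@measurable_funD _ _ _ setT (cst t) id).
have mD2 : measurable D2.
  by rewrite -[X in measurable X]setTI; apply: (@measurable_funB _ _ _ setT (cst t) id).
have : (mu `]0%R, pi[ <= mu (F `|` (D1 `|` D2)))%E.
  apply: le_measure; rewrite ?inE//; first by do 2!apply: measurableU => //.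
  move=> x /=; rewrite in_itv/= => /andP[x0 xp].
  have [Bt|Bt] := pselect (B (t + x)%R); last first.
    by right; left; split => //=; rewrite in_itv/=; apply/andP; split; lra.
  have [Br|Br] := pselect (B (t - x)%R); last first.
    by right; right; split => //=; rewrite in_itv/=; apply/andP; split; lra.
  by left; split => //=; rewrite in_itv/= !ltW.
rewrite lebesgue_measure_itv/= lte_fin p -EFinB subr0 => /le_trans/(_ (lebesgue_measureU2 mF (measurableU _ _ mD1 mD2))) muF.
have D12 : (mu (D1 `|` D2) <= s%:E)%E.
  apply: le_trans (lebesgue_measureU2 mD1 mD2) _.
  rewrite lebesgue_measure_translate// lebesgue_measure_reflect// -lebesgue_measureU//.
    apply: le_trans muC; apply: le_measure; rewrite ?inE.
    - exact: (measurableU _ _ (mI _) (mI _)).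
    - exact: mI.
    move=> x [] [Cx] /=; rewrite in_itv/= => /andP[? ?]; split => //=;
      by rewrite in_itv/=; apply/andP; split; lra.
  apply/seteqP; split => // x /= [[_ +] [_ +]]; rewrite !in_itv/= => /andP[? ?] /andP[? ?]; lra.
have /(le_trans muF) := leeD2l (mu F) D12.
by rewrite -leeBlDr// -EFinB.
Qed.

End Measure.

(** * Trigonometric polynomials: continuity, maximum modulus, even part *)

Section TrigPoly.
Variable R : realType.
Implicit Types (n : nat) (s t x : R) (f : R -> R[i]).

(** The modulus is the square root of X^2 + Y^2, where X and Y are finite real sums of sines and
    cosines. *)
Lemma normc_trigpolyc_continuous n f :
  trigpolyc n f -> continuous (fun t => normc (f t)).
Proof.
move=> [c fE].
pose d (k : 'I_n.*2.+1) : R := (k%:Z - n%:Z)%:~R.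
pose a (k : 'I_n.*2.+1) := c (k%:Z - n%:Z).
pose X t := \sum_k (complex.Re (a k) * cos (d k * t) - complex.Im (a k) * sin (d k * t)).
pose Y t := \sum_k (complex.Re (a k) * sin (d k * t) + complex.Im (a k) * cos (d k * t)).
have -> : (fun t => normc (f t)) = Num.sqrt \o (fun t => X t * X t + Y t * Y t).
  apply/funext => t; rewrite fE /=.
  have E (z : R[i]) : normc z = Num.sqrt (complex.Re z ^+ 2 + complex.Im z ^+ 2) by case: z.
  rewrite E !raddf_sum -!expr2; congr (Num.sqrt (_ ^+ 2 + _ ^+ 2)); apply: eq_bigr => k _.
    by rewrite -/(a k); case: (a k).
  by rewrite -/(a k); case: (a k).
have ct k : continuous (fun t : R => d k * t) by move=> t; exact: mulrl_continuous.
have cc k : continuous (fun t => cos (d k * t)).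
  by move=> t; apply: (continuous_comp (ct k t)); exact: continuous_cos.
have cs k : continuous (fun t => sin (d k * t)).
  by move=> t; apply: (continuous_comp (ct k t)); exact: continuous_sin.
have cX : continuous X.
  apply: (@continuous_big _ _ +%R 0 _ (@add_continuous R)) => k _ t; apply: cvgB.
    by apply: cvgM; [exact: cvg_cst|exact: cc].
  by apply: cvgM; [exact: cvg_cst|exact: cs].
have cY : continuous Y.
  apply: (@continuous_big _ _ +%R 0 _ (@add_continuous R)) => k _ t; apply: cvgD.
    by apply: cvgM; [exact: cvg_cst|exact: cs].
  by apply: cvgM; [exact: cvg_cst|exact: cc].
move=> t; apply: continuous_comp; last exact: sqrt_continuous.
by apply: cvgD; apply: cvgM; [exact: cX|exact: cX|exact: cY|exact: cY].
Qed.

(** Subtracting floor (t / p) periods reduces a global maximum to one over a compact interval. *)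
Lemma periodic_floor (T : Type) (g : R -> T) p t : (forall x, g (x + p) = g x) -> 0 < p ->
  exists2 x, 0 <= x <= p & g x = g t.
Proof.
move=> gp p0; have gz (k : int) x : g (x + k%:~R * p) = g x.
  have N (j : nat) y : g (y + j%:R * p) = g y.
    elim: j y => [|j IH] y; first by rewrite mul0r addr0.
    by rewrite -natr1 mulrDl mul1r addrA gp IH.
  case: k => j; first exact: N.
  by rewrite NegzE mulrNz -[LHS](N j.+1) mulNr subrK.
exists (t - (Num.floor (t / p))%:~R * p).
  have /andP[l u] := floor_itv (t / p).
  rewrite subr_ge0 -ler_pdivlMr// l /= lerBlDr -[X in X + _]mul1r -mulrDl.
  by rewrite -ler_pdivrMr// ltW// addrC -intrD1.
by rewrite -mulNr -mulrNz gz.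
Qed.

Lemma trigpolyc_maximum n f : trigpolyc n f ->
  exists2 t, 0 <= t <= 2 * pi & forall x, normc (f x) <= normc (f t).
Proof.
move=> hf; have p := pi_gt0 R; have p2 : 0 < 2 * pi :> R by lra.
have [|t tI tM] := @EVT_max R (fun t => normc (f t)) 0 (2 * pi) (ltW p2).
  by apply: continuous_subspaceT; exact: normc_trigpolyc_continuous hf.
exists t; first by rewrite in_itv in tI.
move=> x; have [y yI <-] := @periodic_floor _ f _ x (trigpolyc_periodic hf) p2.
by apply: tM; rewrite in_itv.
Qed.

(** For the frequency j the coefficient is c_j e^(i j t0), and e^(ijt) + e^(-ijt) = 2 cos (|j| t).
    The terms for j and -j stay separate, with the same [d]. *)
Lemma trigpolyc_even_part n f t0 : trigpolyc n f ->
  exists (a : 'I_n.*2.+1 -> R[i]) (d : 'I_n.*2.+1 -> nat),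
  [/\ forall i, (d i <= n)%N, f t0 = \sum_i a i &
  forall t, 2%:R * \sum_i a i * (cos ((d i)%:R * t))%:C = f (t0 + t) + f (t0 - t)].
Proof.
move=> [c fE].
have eD x y : expi (x + y) = expi x * expi y.
  by rewrite /expi cosD sinD; apply/eqP; rewrite eq_complex /= addrC [_ * sin y + _]addrC !eqxx.
exists (fun k => c (k%:Z - n%:Z) * expi ((k%:Z - n%:Z)%:~R * t0)).
exists (fun k => `|k%:Z - n%:Z|%N); split=> [k|//|t].
  by have := ltn_ord k; lia.
rewrite !fE -big_split mulr_sumr; apply: eq_bigr => k _ /=.
set j := (k%:Z - n%:Z).
rewrite mulrDr mulrBr -mulrN !eD -!mulrA -mulrDr -mulrDr mulrCA; congr (_ * _).
rewrite mulrCA; congr (_ * _).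
have -> : cos (`|j|%N%:R * t) = cos (j%:~R * t).
  by case: (j) => m //; rewrite NegzE abszN /= mulrNz mulNr cosN.
rewrite mulrN /expi cosN sinN; apply/eqP; rewrite eq_complex /=.
by rewrite !(mul0r, mulr0, subrr, addr0, subr0) eqxx andbT; apply/eqP; ring.
Qed.

End TrigPoly.

(** * The bound for the maximum modulus *)

Unset Implicit Arguments.
Set Strict Implicit.

Theorem theorem2p3 (R : realType) (n : nat) (s : R)
    (hn : (0 < n)%N) (hs0 : 0 < s) (hspi : s < pi)
    (f : R -> R[i]) (hf : trigpolyc_small n s f) :
  (exists M : R, is_maximum (range (fun t => normc (f t))) M /\
     M <= (chebyshev_poly R (2 * n)).[sec (s / 2)]) /\
  (chebyshev_poly R (2 * n)).[sec (s / 2)] =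
    2^-1 * ((sec (s / 2) + tan (s / 2)) ^+ (2 * n) +
            (sec (s / 2) - tan (s / 2)) ^+ (2 * n)).
Proof.
have p := pi_gt0 R; split; last first.
  apply: chebyshev_poly_sec.
  by rewrite gt_eqF// cos_gt0_pihalf//; apply/andP; split; lra.
have [ft muf] := hf; have [t0 t0I t0M] := trigpolyc_maximum ft.
exists (normc (f t0)); split.
  by split; [exists t0|move=> _ [x _ <-]].
have [a [d [dn ft0 fE]]] := trigpolyc_even_part t0 ft.
pose B := [set t | normc (f t) <= 1].
have cB : closed B.
  rewrite -[B]/((fun t => normc (f t)) @^-1` [set x | x <= 1]).
  by apply: preimage_closed; [move=> x _; exact: (normc_trigpolyc_continuous ft)|exact: closed_le].
have pB x : B (x + 2 * pi) <-> B x by rewrite /B /= (trigpolyc_periodic ft).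
have SE : small_set f = B `&` `[- pi, pi[.
  by apply/seteqP; split => x /=; rewrite in_itv /= => -[].
rewrite SE in muf.
have := symmetric_measure_ge cB pB t0I muf.
(* [A] is the set of admissible angles on which the even part about [t0] is bounded by 1. *)
set A := (X in lebesgue_measure X) => muA.
have cA : compact A.
  apply: compact_closedI; first exact: segment_compact.
  apply: closedI.
    apply: (@preimage_closed _ _ (fun x => t0 + x) B) => // x _.
    by apply: cvgD; [exact: cvg_cst|exact: cvg_id].
  apply: (@preimage_closed _ _ (fun x => t0 - x) B) => // x _.
  by apply: cvgB; [exact: cvg_cst|exact: cvg_id].
have A0 : A !=set0.
  apply/set0P/eqP => A0; move: muA; rewrite A0 measure0 lee_fin; lra.
have Ale x : A x -> x <= pi by move=> [] /=; rewrite in_itv => /andP[].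
(* The extremal gaps add up to pi - s, exactly the measure guaranteed for [A]. *)
have [||u [uA u0 ug]] := @compact_gap_points R n (remez_angle n s) A pi _ cA A0 Ale.
- by move=> k kn; exact: remez_angle_lt.
- by rewrite remez_angle0 remez_anglen.
rewrite ft0; apply: (cos_sum_remez hn hs0 hspi dn _ u0 ug) => k kn.
  by have [] := uA k kn; rewrite /= in_itv => /andP[].
have [_ [/= Bp Bm]] := uA k kn.
(* Twice the even part is f (t0 + u k) + f (t0 - u k), and both terms have modulus at most 1. *)
have : normc (2%:R * \sum_i a i * (cos ((d i)%:R * u k))%:C) <= 1 + 1.
  rewrite fE; apply: le_trans (lerD Bp Bm); exact: le_normcD.
rewrite normcM; have -> : normc (2%:R : R[i]) = 2%:R.
  by rewrite /= !addr0 expr0n addr0 sqrtr_sqr ger0_norm.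
lra.
Qed.
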